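(* Let $k\ge1$ and let $a_1,\dots,a_k,b_1,\dots,b_k$ be positive integers, with associated polytope $P\subset\mathbb{R}^n$, $n=b_1+\dots+b_k$. Then $P$ is a normal polytope, and the cone $C_P\subset\mathbb{R}^{n+1}$ is defined by the following set of inequalities: (1) $x_{i,j}\ge0$ for all $i=1,\dots,k$, $j=1,\dots,b_i$, (2) $\sum_{j}x_{i,j}\le a_ix_0$ for all $i=1,\dots,k$, and (3) $\sum_{i,j}x_{i,j}\ge2x_0$.
   Context: The coordinates of $\mathbb{R}^n$ are $x_{i,j}$ with $1\le i\le k$, $1\le j\le b_i$. The polytope $P$ is the convex hull of the finite set of all $\mathbf c=(c_{i,j})\in\mathbb{N}^n$ with $\sum_{j=1}^{b_i}c_{i,j}\le a_i$ for all $i$ and $\sum_{i,j}c_{i,j}\ge2$ (these are the exponent vectors $\mathbf c_\sigma$ of the simplices $\sigma$ of positive dimension of the simplicial complex of the Segre-Veronese variety $v_{a_1}(\mathbb{P}^{b_1})\times\dots\times v_{a_k}(\mathbb{P}^{b_k})$). $C_P$ is the convex cone in $\mathbb{R}^{n+1}=\mathbb{R}\times\mathbb{R}^n$ generated by the vectors in $\{1\}\times P$ (equal to $\{0\}$ if $P=\emptyset$); the extra first coordinate is $x_0$. $L_P\subset\mathbb{Z}^{n+1}$ is the lattice of all integral combinations of the lattice points of $\{1\}\times P$. The polytope $P$ is called normal if every $q\in L_P\cap C_P$ can be written as a finite sum $q=\sum_{i=1}^s p_i$ with $p_i\in(\{1\}\times P)\cap\mathbb{Z}^{n+1}$. *)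

(* Defs.v *)
From HB Require Import structures.
From mathcomp Require Import all_boot all_order all_algebra.
From mathcomp Require Import boolp classical_sets reals convex.

Set Implicit Arguments.
Unset Strict Implicit.
Unset Printing Implicit Defensive.

Import Order.TTheory GRing.Theory Num.Theory.

Local Open Scope classical_set_scope.
Local Open Scope ring_scope.

(* R^I and R x R^I; R^o is R seen as a module over itself, and the first
   component of ext_space is the extra coordinate x_0. *)
Notation coord_space R I := {ffun I -> R^o}.
Notation ext_space R I := (R^o * {ffun I -> R^o})%type.

Section ConvexGeometry.
Variable R : realType.

Definition convex_hull (V : lmodType R) (A : set V) : set V :=
  smallest (@convex_set R V) A.

(* The empty combination is allowed, so the cone generated by set0 is {0}. *)
Definition convex_cone (V : lmodType R) (A : set V) : set V :=
  [set v | exists s (t : 'I_s -> R) (p : 'I_s -> V),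
     [/\ forall i, 0 <= t i, forall i, A (p i) & v = \sum_i t i *: p i]].

Definition integral_span (V : zmodType) (A : set V) : set V :=
  [set v | exists s (m : 'I_s -> int) (p : 'I_s -> V),
     (forall i, A (p i)) /\ v = \sum_i p i *~ m i].

Variable I : finType.
Implicit Type P : set (coord_space R I).

Definition integer_points : set (ext_space R I) :=
  [set q : ext_space R I |
     q.1 \is a Num.int /\ forall u, q.2 u \is a Num.int].

Definition at_height1 P : set (ext_space R I) :=
  [set q : ext_space R I | q.1 = 1 /\ P q.2].

Definition cone_over P := convex_cone (V := ext_space R I) (at_height1 P).

Definition lattice_of P :=
  integral_span (V := ext_space R I) (at_height1 P `&` integer_points).

Definition normal_polytope P :=
  forall q, (lattice_of P `&` cone_over P) q ->
    exists s (p : 'I_s -> ext_space R I),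
      (forall i, (at_height1 P `&` integer_points) (p i)) /\ q = \sum_i p i.

End ConvexGeometry.

Section SegreVeronese.
Variables (k : nat) (a b : 'I_k -> nat).

(* The index set of the coordinates x_{i,j}, 1 <= i <= k, 1 <= j <= b_i. *)
Definition sv_index := {i : 'I_k & 'I_(b i)}.

Definition sv_ix (i : 'I_k) (j : 'I_(b i)) : sv_index :=
  Tagged (fun i => 'I_(b i)) j.
Arguments sv_ix : clear implicits.

Definition sv_exponent (c : {ffun sv_index -> nat}) : Prop :=
  (forall i, \sum_j c (sv_ix i j) <= a i)%N
  /\ (2 <= \sum_i \sum_j c (sv_ix i j))%N.

Definition sv_polytope (R : realType) : set (coord_space R sv_index) :=
  convex_hull (V := coord_space R sv_index)
    [set ([ffun u => (c u)%:R] : coord_space R sv_index)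
       | c in [set c | sv_exponent c]].

End SegreVeronese.

Arguments sv_ix {k b} i j.
Arguments sv_polytope {k} a b R.

(* Main.v *)
(** Let x be a point satisfying the inequalities at height x_0 = 1.  Order the
    coordinates block by block, let S_u be the sum of the coordinates preceding
    u, and for a real theta let c^theta_u = floor(S_u + x_u + theta) -
    floor(S_u + theta).  Sums of consecutive entries of c^theta telescope, and
    all bounds in the inequalities are integers, so c^theta is an exponent vector.
    - The integral of floor(s + theta) over theta in [0, 1] is s, so x is the
      average of the c^theta; as these take finitely many values, x is a convex
      combination of them.
    - If x = q / d with q integral, the average over theta = r / d, 0 <= r < d,
      is already x by Hermite's identity, so q is the sum of these d exponent
      vectors. *)
Require Import Defs.
From HB Require Import structures.
From mathcomp Require Import all_boot all_order all_algebra.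
From mathcomp Require Import boolp classical_sets reals convex.
From mathcomp Require Import interval_inference lra.

Set Implicit Arguments.
Unset Strict Implicit.
Unset Printing Implicit Defensive.

Import Order.TTheory GRing.Theory Num.Theory.

Local Open Scope classical_set_scope.
Local Open Scope ring_scope.

(** * Partial sums, telescoping, and averages of shifted floors *)

Definition psum (V : nmodType) n (f : 'I_n -> V) (m : nat) : V :=
  \sum_(i < n | (i < m)%N) f i.

Lemma psum0 (V : nmodType) n (f : 'I_n -> V) : psum f 0 = 0.
Proof. by rewrite /psum big_pred0. Qed.

Lemma psum_all (V : nmodType) n (f : 'I_n -> V) : psum f n = \sum_i f i.
Proof. by apply: eq_bigl => i; rewrite ltn_ord. Qed.

Lemma psumS (V : nmodType) n (f : 'I_n -> V) (i : 'I_n) :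
  psum f i.+1 = psum f i + f i.
Proof.
rewrite /psum (bigD1 i) ?ltnS //= addrC; congr (_ + _).
by apply: eq_bigl => j; rewrite ltnS ltn_neqAle andbC.
Qed.

Lemma telescope_ord (V : zmodType) n (F : nat -> V) :
  \sum_(i < n) (F i.+1 - F i) = F n - F 0.
Proof. by rewrite -telescope_sumr // big_mkord. Qed.

(* Hermite's identity at the rational point m / d. *)
Lemma sum_floor_shift (R : realType) (d m : nat) : (0 < d)%N ->
  \sum_(r < d) (Num.floor (m%:R / d%:R + r%:R / d%:R : R))%:~R = m%:R :> R.
Proof.
move=> d_gt0; have d_neq0 : d%:R != 0 :> R by rewrite pnatr_eq0 -lt0n.
have floor_small n : (n < d)%N -> Num.floor (n%:R / d%:R : R) = 0.
  move=> lt_nd; apply/eqP; rewrite floor_eq add0r divr_ge0 //=.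
  by rewrite ltr_pdivrMr ?ltr0n // mul1r ltr_nat.
elim: m => [|m IHm].
  by rewrite big1 // => r _; rewrite mul0r add0r floor_small.
(* Replacing [m] by [m.+1] has the effect of replacing [r] by [r.+1], so the two sums differ by
   [F d - F 0], which is 1 because [F d] has argument [m / d + 1]. *)
rewrite -[RHS]nat1r -[X in _ = _ + X]IHm; apply/eqP; rewrite -subr_eq -sumrB.
pose F n : R := (Num.floor (m%:R / d%:R + n%:R / d%:R : R))%:~R.
apply/eqP; rewrite (eq_bigr (fun r : 'I_d => F r.+1 - F r)) => [|r _].
  rewrite telescope_ord /F mul0r addr0 divff // floorDrz ?rpred1 //.
  by rewrite floor1 rmorphD /= addrC addKr.
rewrite /F; congr (_ - _); congr (_%:~R); congr (Num.floor _).
by rewrite -!nat1r !mulrDl [RHS]addrCA addrA.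
Qed.

(* The integral of [floor (x + t)] over [0 <= t <= 1], evaluated as a finite sum on
   a subdivision [t] of [0, 1] containing all discontinuities [1 - frac x]. *)
Lemma floor_average (R : realType) (S : seq R) :
  exists n (w t : 'I_n -> R),
    [/\ forall k, 0 <= w k, \sum_k w k = 1 &
        forall x, x \in S -> \sum_k w k * (Num.floor (x + t k))%:~R = x].
Proof.
pose fl (x : R) : R := (Num.floor x)%:~R.
have flx (x : R) : 0 <= x - fl x < 1.
  have := floor_itv x; rewrite -/(fl x) intrD -/(fl x) => /andP[? ?]; lra.
pose ts := sort <=%R (0 :: [seq 1 - (x - fl x) | x <- S]).
(* The default value of [nth] makes 1 the right end of the subdivision. *)
pose n := size ts; pose T := nth 1 ts.
have T_itv k : 0 <= T k <= 1.
  have [lt_kn|le_nk] := ltnP k n; last by rewrite /T nth_default // ler01 lexx.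
  have : T k \in ts by apply: mem_nth.
  rewrite mem_sort inE => /orP[/eqP ->|/mapP[x _ ->]].
    by rewrite lexx ler01.
  by have /andP[? ?] := flx x; apply/andP; split; lra.
have T_mono j k : (j <= k)%N -> T j <= T k.
  move=> le_jk; have [lt_kn|le_nk] := ltnP k n.
    apply: (sorted_leq_nth le_trans le_refl) => //; last first.
    - by rewrite inE (leq_ltn_trans le_jk).
    - by apply: sort_sorted; apply: le_total.
  by rewrite {2}/T nth_default //; case/andP: (T_itv j).
have Tn : T n = 1 by rewrite /T nth_default.
have T_0 : T 0 = 0.
  apply/eqP; rewrite eq_le; case/andP: (T_itv 0%N) => -> _; rewrite andbT.
  have in0 : 0 \in ts by rewrite mem_sort inE eqxx.
  rewrite -[leRHS](nth_index 1 in0); exact: T_mono.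
exists n, (fun k => T k.+1 - T k), T; split.
- by move=> k; rewrite subr_ge0 T_mono.
- by rewrite telescope_ord Tn T_0 subr0.
move=> x xS; have /andP[fr_ge0 fr_lt1] := flx x.
pose tau := 1 - (x - fl x).
have tau_ts : tau \in ts.
  rewrite mem_sort inE; apply/orP; right.
  exact: (map_f (fun z => 1 - (z - fl z)) xS).
pose l := index tau ts; have Tl : T l = tau by apply: nth_index.
have lt_ln : (l < n)%N by rewrite index_mem.
(* As the shift runs through [0, 1], the floor jumps exactly once, by 1, at [tau]. *)
have floorE k : fl (x + T k) = fl x + (tau <= T k)%R%:R.
  case/andP: (T_itv k) => T_ge0 T_le1; rewrite /fl; case: lerP => [ge|lt].
    rewrite (_ : Num.floor (x + T k) = Num.floor x + 1) ?intrD //.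
    by apply: floor_def; rewrite !intrD -/(fl x); apply/andP; split;
       rewrite /tau in ge; lra.
  rewrite addr0; congr _%:~R; apply: floor_def.
  by rewrite !intrD -/(fl x); apply/andP; split; rewrite /tau in lt; lra.
transitivity (\sum_(k < n) (T k.+1 - T k) * (fl x + (tau <= T k)%R%:R)).
  by apply: eq_bigr => k _; rewrite -floorE.
under eq_bigr do rewrite mulrDr; rewrite big_split /= -mulr_suml telescope_ord.
rewrite Tn T_0 subr0 mul1r.
rewrite -(big_mkord xpredT (fun k => (T k.+1 - T k) * (tau <= T k)%R%:R)).
(* Before index [l] each term vanishes: either [T k < tau], or monotonicity forces
   [T k = T k.+1 = tau]. From [l] on, the lengths telescope to [1 - tau], the fractional part of
   [x]. *)
rewrite (big_cat_nat (n := l)) //=; last exact: ltnW.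
rewrite big_nat_cond big1 => [|k /andP[/andP[_ lt_kl] _]]; last first.
  have [ge|] := lerP tau (T k); last by rewrite mulr0.
  have le1 := T_mono _ _ lt_kl; have le2 := T_mono _ _ (leqnSn k).
  rewrite Tl in le1; rewrite mulr1; apply/eqP.
  by rewrite subr_eq0 eq_le le2 andbT; lra.
rewrite add0r big_nat (eq_bigr (fun k => T k.+1 - T k)).
  by rewrite -big_nat telescope_sumr ?(ltnW lt_ln) // Tn Tl /tau; lra.
by move=> k /andP[le_lk _]; rewrite -Tl T_mono // mulr1.
Qed.

(** * Integral slices of a real point *)

Section Slices.
Variables (R : realType) (k : nat) (a b : 'I_k -> nat).
Implicit Types (y : coord_space R (sv_index b)) (theta : R).

Definition block_sum y (i : 'I_k) : R := \sum_j y (sv_ix i j).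

(* [position y i j] is S_u for u = (i, j), and [position y i j.+1] is S_u + y_u. *)
Definition position y (i : 'I_k) (m : nat) : R :=
  psum (block_sum y) i + psum (fun j => y (sv_ix i j) : R) m.

(** This is c^theta. [absz] only serves to land in [nat]: the difference of floors is nonnegative as
    soon as [y] is. *)
Definition slice y theta : {ffun sv_index b -> nat} :=
  [ffun u : sv_index b => let: existT i j := u in
    absz (Num.floor (position y i j.+1 + theta)
          - Num.floor (position y i j + theta))%R].

Definition sv_cone : set (ext_space R (sv_index b)) :=
  [set x : ext_space R (sv_index b) |
      [/\ forall (i : 'I_k) (j : 'I_(b i)), 0 <= x.2 (sv_ix i j),
          forall i : 'I_k, \sum_(j < b i) x.2 (sv_ix i j) <= (a i)%:R * x.1
        & \sum_(i < k) \sum_(j < b i) x.2 (sv_ix i j) >= 2 * x.1]].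

Lemma positionS y i (j : 'I_(b i)) :
  position y i j.+1 = position y i j + y (sv_ix i j).
Proof. by rewrite /position psumS addrA. Qed.

Lemma sliceE y theta i (j : 'I_(b i)) : (forall v, 0 <= y v) ->
  Posz (slice y theta (sv_ix i j)) =
  Num.floor (position y i j.+1 + theta) - Num.floor (position y i j + theta).
Proof.
move=> y_ge0; rewrite ffunE gez0_abs // subr_ge0; apply: le_floor.
by rewrite lerD2r positionS lerDl y_ge0.
Qed.

(** The end of block [i] is the start of block [i.+1], so the sum telescopes within a block, and the
    result telescopes again over blocks. *)
Lemma block_slice y theta i : (forall v, 0 <= y v) ->
  Posz (\sum_j slice y theta (sv_ix i j)) =
  Num.floor (psum (block_sum y) i.+1 + theta)
  - Num.floor (psum (block_sum y) i + theta).
Proof.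
move=> y_ge0; rewrite (big_morph Posz PoszD (erefl _)).
under eq_bigr do rewrite sliceE //=.
rewrite (telescope_ord _ (fun m => Num.floor (position y i m + theta))).
by rewrite /position psum0 addr0 psum_all psumS.
Qed.

Lemma floorDn (x : R) (n : nat) : Num.floor (x + n%:R) = Num.floor x + n%:Z.
Proof. by rewrite floorDrz ?natr_int // -[n%:R]/(n%:Z%:~R) intrKfloor. Qed.

(** The bounds [a i] and 2 are integers, so [floorDn] moves them inside the floor, where
    monotonicity turns the real inequalities into integral ones. *)
Lemma slice_exponent y theta : sv_cone (1, y) -> sv_exponent a (slice y theta).
Proof.
case=> /= y_ge0 y_le y_ge.
have {}y_ge0 v : 0 <= y v by case: v => i j; exact: y_ge0.
split=> [i|].
  rewrite -lez_nat block_slice // lerBlDl -floorDn psumS; apply: le_floor.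
  by rewrite addrAC lerD2l (le_trans (y_le i)) ?mulr1.
rewrite -lez_nat (big_morph Posz PoszD (erefl _)).
under eq_bigr do rewrite block_slice //.
rewrite (telescope_ord _ (fun m => Num.floor (psum (block_sum y) m + theta))).
rewrite psum0 add0r psum_all lerBrDl -floorDn; apply: le_floor.
by rewrite [leLHS]addrC lerD2r (le_trans _ y_ge) ?mulr1.
Qed.

(** General weights of total [x0] cover both uses: the real weights of [floor_average] and the unit
    weights of Hermite's identity. Only the positions at the two ends of a coordinate matter. *)
Lemma sum_slice y (x0 : R) n (w t : 'I_n -> R) i (j : 'I_(b i)) :
  (forall v, 0 <= y v) ->
  (forall m, m \in [:: nat_of_ord j; j.+1] ->
   \sum_r w r * (Num.floor (position y i m + t r))%:~R = x0 * position y i m) ->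
  \sum_r w r * (slice y (t r) (sv_ix i j))%:R = x0 * y (sv_ix i j).
Proof.
move=> y_ge0 avg.
under eq_bigr => r do rewrite -[_%:R]/((Posz _)%:~R) sliceE // intrB mulrBr.
by rewrite sumrB !avg ?inE ?eqxx ?orbT // -mulrBr positionS addrC addKr.
Qed.

(** * The cone cut out by the inequalities *)

Lemma sv_cone_ge0 (q : ext_space R (sv_index b)) :
  (1 <= k)%N -> (forall i, 0 < a i)%N -> sv_cone q -> 0 <= q.1.
Proof.
(* A single block suffices: its sum is nonnegative and at most [a i * q.1] with [a i] positive. *)
move=> k_gt0 a_gt0 [q_ge0 q_le _]; have := q_le (Ordinal k_gt0).
by move/(le_trans (sumr_ge0 _ (fun j _ => q_ge0 _ j))); rewrite pmulr_rge0 ?ltr0n.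
Qed.

Lemma sv_cone0 : sv_cone 0.
Proof.
split=> [i j|i|] /=.
- by rewrite ffunE.
- by rewrite mulr0 big1 // => j _; rewrite ffunE.
- by rewrite mulr0 big1 // => i _; rewrite big1 // => j _; rewrite ffunE.
Qed.

Lemma sv_coneD p q : sv_cone p -> sv_cone q -> sv_cone (p + q).
Proof.
case=> p0 p1 p2 [q0 q1 q2]; split=> [i j|i|] /=.
- by rewrite ffunE addr_ge0 ?p0 ?q0.
- under eq_bigr do rewrite ffunE; rewrite big_split mulrDr /=.
  by rewrite lerD ?p1 ?q1.
- under eq_bigr => i _ do
    [under eq_bigr do rewrite ffunE; rewrite big_split /=].
  by rewrite big_split mulrDr /= lerD.
Qed.

Lemma sv_coneZ (c : R) p : 0 <= c -> sv_cone p -> sv_cone (c *: p).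
Proof.
move=> c_ge0 [p0 p1 p2]; split=> [i j|i|] /=.
- by rewrite ffunE mulr_ge0 ?p0.
- under eq_bigr do rewrite ffunE; rewrite -mulr_sumr mulrCA.
  by rewrite ler_wpM2l ?p1.
- under eq_bigr => i _ do
    [under eq_bigr do rewrite ffunE; rewrite -mulr_sumr].
  by rewrite -mulr_sumr mulrCA ler_wpM2l.
Qed.

Lemma sv_cone_convex : convex_set
  ([set y | sv_cone (1, y)] : set (convex_lmodType (coord_space R (sv_index b)))).
Proof.
move=> x y l; rewrite !inE => cx cy.
have l1 : 0 <= 1 - l%:num by rewrite subr_ge0.
apply: (eq_ind _ sv_cone (sv_coneD (sv_coneZ (ge0 l) cx) (sv_coneZ l1 cy))).
congr pair; rewrite /= /GRing.scale /= !mulr1; exact: subrKC.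
Qed.

(** * Lattice points of the polytope and the cone over it *)

Definition lattice_vector (c : {ffun sv_index b -> nat}) :
  ext_space R (sv_index b) :=
  (1, [ffun u => (c u)%:R]).

Lemma lattice_vectorP c : sv_exponent a c ->
  (at_height1 (sv_polytope a b R) `&` @integer_points R (sv_index b))
    (lattice_vector c).
Proof.
move=> exp_c; split; split=> //=.
  by apply: sub_gen_smallest; exists c.
by move=> u; rewrite ffunE natr_int.
Qed.

(** The inequalities are stable under nonnegative combinations and convex at height 1, so checking
    them on exponent vectors is enough. *)
Lemma sub_sv_cone : cone_over (sv_polytope a b R) `<=` sv_cone.
Proof.
have hull_sub : sv_polytope a b R `<=` [set y | sv_cone (1, y)].
  apply: smallest_sub; first exact: sv_cone_convex.
  move=> _ [c [c_le c_ge] <-]; split=> [i j|i|] /=.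
  - by rewrite ffunE.
  - by under eq_bigr do rewrite ffunE; rewrite mulr1 -natr_sum ler_nat c_le.
  - under eq_bigr => i _ do [under eq_bigr do rewrite ffunE; rewrite -natr_sum].
    by rewrite mulr1 -natr_sum ler_nat.
move=> _ [s [t [p [t_ge0 Pp ->]]]].
elim/big_ind: _ => [|x y|i _]; first exact: sv_cone0.
  exact: sv_coneD.
apply: sv_coneZ => //; case: (p i) (Pp i) => x y [/= -> ]; exact: hull_sub.
Qed.

Lemma scale_to_height1 (q : ext_space R (sv_index b)) :
  0 < q.1 -> sv_cone q -> sv_cone (1, [ffun u => q.1^-1 * q.2 u]).
Proof.
move=> q1_gt0 cone_q; have q1V_ge0 : 0 <= q.1^-1 by rewrite invr_ge0 ltW.
apply: (eq_ind _ sv_cone (sv_coneZ q1V_ge0 cone_q)).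
by congr pair; rewrite /= /GRing.scale /= mulVf ?gt_eqF.
Qed.

(** The common core of both conclusions: real weights put [q] in the cone over the polytope, and
    unit weights write it as a sum of lattice points. *)
Lemma sum_lattice_slice (q : ext_space R (sv_index b)) n (w t : 'I_n -> R) :
  let y := [ffun u => q.1^-1 * q.2 u] in
  0 < q.1 -> sv_cone q -> \sum_r w r = q.1 ->
  (forall i (j : 'I_(b i)) m, m \in [:: nat_of_ord j; j.+1] ->
   \sum_r w r * (Num.floor (position y i m + t r))%:~R = q.1 * position y i m) ->
  q = \sum_r w r *: lattice_vector (slice y (t r)).
Proof.
move=> y q1_gt0 cone_q sum_w avg.
have [/= y_ge0 _ _] := scale_to_height1 q1_gt0 cone_q.
rewrite [LHS]surjective_pairing; apply: injective_projections.
  rewrite [RHS]raddf_sum /= -sum_w; apply: eq_bigr => r _.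
  by rewrite /GRing.scale /= mulr1.
rewrite [RHS]raddf_sum; apply/ffunP => -[i j] /=; rewrite sum_ffunE.
have -> : q.2 (sv_ix i j) = q.1 * y (sv_ix i j).
  by rewrite ffunE mulVKf ?gt_eqF.
rewrite -(@sum_slice y q.1 n w t i j); last exact: avg.
  by apply: eq_bigr => r _; rewrite !ffunE.
by case=> *; exact: y_ge0.
Qed.

Lemma sv_cone_height0 (q : ext_space R (sv_index b)) :
  sv_cone q -> q.1 = 0 -> q = 0.
Proof.
case: q => x0 x [/= x_ge0 x_le _] x0_eq0; rewrite x0_eq0 in x_le *.
congr pair; apply/ffunP => -[i j]; rewrite ffunE; apply/eqP.
rewrite eq_le x_ge0 andbT; have := x_le i; rewrite mulr0; apply: le_trans.
by rewrite (bigD1 j) //= lerDl sumr_ge0.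
Qed.

Lemma sv_cone_sub : (1 <= k)%N -> (forall i, 0 < a i)%N ->
  sv_cone `<=` cone_over (sv_polytope a b R).
Proof.
move=> k_gt0 a_gt0 q cone_q.
have := sv_cone_ge0 k_gt0 a_gt0 cone_q.
rewrite le_eqVlt => /predU1P[/esym q1_eq0|q1_gt0].
  (* At height 0 only the origin remains, and it is the empty combination. *)
  exists 0%N, (fun=> 0), (fun=> 0); split=> [[]|[]|] //.
  by rewrite big_ord0 (sv_cone_height0 cone_q).
pose y : coord_space R (sv_index b) := [ffun u => q.1^-1 * q.2 u].
(* One finite subdivision has to average the floor correctly at every position at once, so all
   endpoints are collected in a single list. *)
pose ends (u : sv_index b) : seq R := let: existT i j := u in
  [seq position y i m | m <- [:: nat_of_ord j; j.+1]].
have [n [w [t [w_ge0 sum_w avg]]]] := floor_average (flatten (codom ends)).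
exists n, (fun r => q.1 * w r), (fun r => lattice_vector (slice y (t r))).
split=> [r|r|]; first by rewrite mulr_ge0 // ltW.
  have cone_y := scale_to_height1 q1_gt0 cone_q.
  by have [] := lattice_vectorP (slice_exponent (t r) cone_y).
apply: sum_lattice_slice => //; first by rewrite -mulr_sumr sum_w mulr1.
move=> i j m m_j; under eq_bigr do rewrite -mulrA; rewrite -mulr_sumr avg //.
apply/flattenP; exists (ends (sv_ix i j)); first exact: codom_f.
exact: (map_f (position y i)).
Qed.

(** * Normality of the polytope *)

Lemma lattice_integral (q : ext_space R (sv_index b)) :
  lattice_of (sv_polytope a b R) q -> @integer_points R (sv_index b) q.
Proof.
move=> [s [m [p [lat_p ->]]]].
elim/big_ind: _ => [|x y [x1 x2] [y1 y2]|i _].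
- by split=> [|u] /=; rewrite ?ffunE rpred0.
- by split=> [|u] /=; rewrite ?ffunE rpredD.
have [_ [p1 p2]] := lat_p i; rewrite -scaler_int.
by split=> [|u] /=; rewrite ?ffunE rpredM // intr_int.
Qed.

Lemma sv_polytope_normal : (1 <= k)%N -> (forall i, 0 < a i)%N ->
  normal_polytope (sv_polytope a b R).
Proof.
move=> k_gt0 a_gt0 q [/lattice_integral[q1_int q2_int] /sub_sv_cone cone_q].
have q1_ge0 := sv_cone_ge0 k_gt0 a_gt0 cone_q.
have /natrP[d q1E] : q.1 \is a Num.nat by rewrite natrEint q1_int.
have [d_eq0|d_gt0] := posnP d.
  exists 0%N, (fun=> 0); split; first by case.
  by rewrite big_ord0 (sv_cone_height0 cone_q) // q1E d_eq0.
have q1_gt0 : 0 < q.1 by rewrite q1E ltr0n.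
pose y : coord_space R (sv_index b) := [ffun u => q.1^-1 * q.2 u].
(* Each summand has height 1, so the number of summands is the height [d] of [q]; the shifts are
   those of Hermite's identity. *)
exists d, (fun r => lattice_vector (slice y (r%:R / d%:R))); split=> [r|].
  exact/lattice_vectorP/slice_exponent/scale_to_height1.
under eq_bigr do rewrite -[lattice_vector _]scale1r.
apply: sum_lattice_slice => //; first by rewrite sumr_const card_ord q1E.
move=> i j m _; under eq_bigr do rewrite mul1r; rewrite -/y.
(* Integrality of [q] makes every position a fraction [p / d], the form that [sum_floor_shift]
   requires. *)
have y_nat u : q.1 * y u \is a Num.nat.
  rewrite ffunE mulVKf ?gt_eqF // natrEint q2_int.
  by have [ge0 _ _] := cone_q; case: u => *; exact: ge0.
have /natrP[p pE] : q.1 * position y i m \is a Num.nat.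
  rewrite mulrDr rpredD //; rewrite mulr_sumr rpred_sum // => l _.
  by rewrite mulr_sumr rpred_sum.
have -> : position y i m = p%:R / d%:R.
  by rewrite -pE q1E mulrC mulKf // -q1E gt_eqF.
by rewrite sum_floor_shift // q1E mulrC divfK // -q1E gt_eqF.
Qed.

End Slices.

Theorem lemma3p4 (R : realType) (k : nat) (a b : 'I_k -> nat)
    (hk : (1 <= k)%N) (ha : forall i, (0 < a i)%N) (hb : forall i, (0 < b i)%N) :
  normal_polytope (sv_polytope a b R) /\
  cone_over (sv_polytope a b R) =
    [set x : ext_space R (sv_index b) |
      [/\ forall (i : 'I_k) (j : 'I_(b i)), 0 <= x.2 (sv_ix i j),
          forall i : 'I_k, \sum_(j < b i) x.2 (sv_ix i j) <= (a i)%:R * x.1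
        & \sum_(i < k) \sum_(j < b i) x.2 (sv_ix i j) >= 2 * x.1]].
Proof.
split; first exact: sv_polytope_normal.
by apply/seteqP; split; [exact: sub_sv_cone|exact: sv_cone_sub].
Qed.
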